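(* Let $H$ be a finite dimensional Hopf $\pi$-coalgebra over a field $\Bbbk$. Then the $\Bbbk$-vector space of left $\pi$-integrals for $H$ is one-dimensional, and the $\Bbbk$-vector space of right $\pi$-integrals for $H$ is one-dimensional.
   Context: Throughout, $\pi$ is a discrete group with neutral element $1$, $\Bbbk$ is a field, $\otimes=\otimes_\Bbbk$, and algebras are associative and unital over $\Bbbk$ (the zero algebra is allowed). A $\pi$-coalgebra is a family $C=\{C_\alpha\}_{\alpha\in\pi}$ of $\Bbbk$-spaces with $\Bbbk$-linear maps $\Delta_{\alpha,\beta}:C_{\alpha\beta}\to C_\alpha\otimes C_\beta$ and $\epsilon:C_1\to\Bbbk$ such that $(\Delta_{\alpha,\beta}\otimes\mathrm{id}_{C_\gamma})\Delta_{\alpha\beta,\gamma}=(\mathrm{id}_{C_\alpha}\otimes\Delta_{\beta,\gamma})\Delta_{\alpha,\beta\gamma}$ and $(\mathrm{id}_{C_\alpha}\otimes\epsilon)\Delta_{\alpha,1}=\mathrm{id}_{C_\alpha}=(\epsilon\otimes\mathrm{id}_{C_\alpha})\Delta_{1,\alpha}$ for all $\alpha,\beta,\gamma\in\pi$. A Hopf $\pi$-coalgebra is a $\pi$-coalgebra $H=(\{H_\alpha\},\Delta,\epsilon)$ with $\Bbbk$-linear maps $S_\alpha:H_\alpha\to H_{\alpha^{-1}}$ (the antipode) such that each $H_\alpha$ is an algebra with multiplication $m_\alpha$ and unit $1_\alpha$, the maps $\epsilon$ and all $\Delta_{\alpha,\beta}$ are algebra homomorphisms, and $m_\alpha(S_{\alpha^{-1}}\otimes\mathrm{id}_{H_\alpha})\Delta_{\alpha^{-1},\alpha}=\epsilon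 1_\alpha=m_\alpha(\mathrm{id}_{H_\alpha}\otimes S_{\alpha^{-1}})\Delta_{\alpha,\alpha^{-1}}$ for all $\alpha$. $H$ is finite dimensional if every $H_\alpha$ is finite dimensional over $\Bbbk$. A left (resp. right) $\pi$-integral for $H$ is a family of linear forms $\lambda=(\lambda_\alpha)_{\alpha\in\pi}\in\prod_{\alpha\in\pi}H_\alpha^*$ such that for all $\alpha,\beta\in\pi$, $(\mathrm{id}_{H_\alpha}\otimes\lambda_\beta)\Delta_{\alpha,\beta}=\lambda_{\alpha\beta}\,1_\alpha$ (resp. $(\lambda_\alpha\otimes\mathrm{id}_{H_\beta})\Delta_{\alpha,\beta}=\lambda_{\alpha\beta}\,1_\beta$). *)

(* Defs.v *)
From HB Require Import structures.
From mathcomp Require Import all_boot all_order all_algebra.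
From mathcomp Require Import boolp.

Set Implicit Arguments.
Unset Strict Implicit.
Unset Printing Implicit Defensive.

Import GRing.Theory.
Local Open Scope ring_scope.

Reserved Notation "x ⊗ y" (at level 40, left associativity).
Reserved Notation "x ∗ y" (at level 40, left associativity).

(* Finite dimensional associative unital algebras.  Those of MathComp          *)
(* (algType, falgType) satisfy 1 != 0, but the zero algebra is allowed here.   *)
HB.mixin Record Vector_isFdAlgebra (K : fieldType) A of Vector K A := {
  amul : A -> A -> A;
  aone : A;
  amulA : associative amul;
  amul1l : left_id aone amul;
  amul1r : right_id aone amul;
  amul_linl : forall y : A, linear (amul^~ y);
  amul_linr : forall x : A, linear (amul x)
}.

#[short(type="fdAlgebra")]
HB.structure Definition FdAlgebra (K : fieldType) :=
  {A of Vector K A & Vector_isFdAlgebra K A}.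

Notation "x ∗ y" := (amul x y) : ring_scope.

Definition alg_morphism (K : fieldType) (A B : fdAlgebra K) (f : A -> B) :=
  [/\ linear f, f aone = aone & {morph f : x y / x ∗ y}].

Section RegularAlgebra.
Variable K : fieldType.

Fact regular_mulDl (y : K^o) : linear (fun x : K^o => x * y : K^o).
Proof. by move=> k x x'; rewrite mulrDl scalerAl. Qed.

Fact regular_mulDr (x : K^o) : linear (fun y : K^o => x * y : K^o).
Proof. by move=> k y y'; rewrite mulrDr -[k *: y]/(k * y) mulrCA. Qed.

HB.instance Definition _ := Vector_isFdAlgebra.Build K K^o
  (@mulrA K) (@mul1r K) (@mulr1 K) regular_mulDl regular_mulDr.

End RegularAlgebra.

(* Tensor products of finite dimensional spaces, modelled by coordinates on    *)
(* the e_i ⊗ f_j, for the chosen bases e of U and f of V.  Only the universal  *)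
(* property (tlift_pure, tensor_ext) matters: all operations below are         *)
(* defined through tlift.                                                      *)
Definition tensor (K : fieldType) (U V : vectType K) :=
  'M[K]_(\dim {:U}, \dim {:V}).

HB.instance Definition _ (K : fieldType) (U V : vectType K) :=
  Vector.copy (tensor U V) 'M[K]_(\dim {:U}, \dim {:V}).

Notation "U ⊗ V" := (tensor U V) : type_scope.

Definition pure (K : fieldType) (U V : vectType K) (u : U) (v : V) :
    (U ⊗ V)%type :=
  \matrix_(i, j) (coord (vbasis {:U}) i u * coord (vbasis {:V}) j v).

Notation "u ⊗ v" := (pure u v) : ring_scope.

(* The linear map on U ⊗ V induced by a bilinear map f.                        *)
Definition tlift (K : fieldType) (U V : vectType K) (W : lmodType K)
    (f : U -> V -> W) (t : (U ⊗ V)%type) : W :=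
  \sum_i \sum_j t i j *: f (vbasis {:U})`_i (vbasis {:V})`_j.

Definition bilin (K : fieldType) (U V W : lmodType K) (f : U -> V -> W) :=
  (forall u, linear (f u)) /\ (forall v, linear (f^~ v)).

Section TensorTheory.
Variable K : fieldType.
Implicit Types U V : vectType K.

Lemma pure_bilin U V : bilin (@pure K U V).
Proof.
split=> [u k v w|v k u w]; apply/matrixP=> i j; rewrite !mxE linearP /=.
  by rewrite mulrDr mulrCA.
by rewrite mulrDl mulrA.
Qed.

Lemma tlift_is_linear U V (W : lmodType K) (f : U -> V -> W) :
  linear (tlift f).
Proof.
move=> k s t; rewrite /tlift scaler_sumr -big_split; apply: eq_bigr => i _.
rewrite scaler_sumr -big_split; apply: eq_bigr => j _.
by rewrite !mxE scalerDl scalerA.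
Qed.

HB.instance Definition _ U V (W : lmodType K) (f : U -> V -> W) :=
  GRing.isLinear.Build K (U ⊗ V)%type W _ (tlift f) (tlift_is_linear f).

Lemma tlift_pure U V (W : lmodType K) (f : U -> V -> W) u v :
  bilin f -> tlift f (u ⊗ v) = f u v.
Proof.
move=> [fl fr].
pose fL u0 := GRing.isLinear.Build K V W _ (f u0) (fl u0).
pose FL u0 : {linear V -> W} := HB.pack (f u0) (fL u0).
pose fR := GRing.isLinear.Build K U W _ (f^~ v) (fr v).
pose FR : {linear U -> W} := HB.pack (f^~ v) fR.
rewrite [in RHS](coord_vbasis (memvf u)) -[RHS]/(FR _) linear_sum /tlift.
apply: eq_bigr => i _; rewrite linearZ /=.
rewrite [in RHS](coord_vbasis (memvf v)) -[f _ _]/(FL _ _) linear_sum.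
rewrite scaler_sumr; apply: eq_bigr => j _; rewrite linearZ /= scalerA.
by rewrite !mxE.
Qed.

Lemma tensor_pureE U V (t : (U ⊗ V)%type) :
  t = \sum_i \sum_j t i j *: ((vbasis {:U})`_i ⊗ (vbasis {:V})`_j).
Proof.
have fU := basis_free (vbasisP {:U}); have fV := basis_free (vbasisP {:V}).
apply/matrixP=> k l; rewrite summxE (bigD1 k) //= summxE (bigD1 l) //=.
rewrite !mxE !coord_free // !eqxx !mulr1 !big1 ?addr0 // => i /negPf nki.
  rewrite summxE big1 // => j _; rewrite !mxE !coord_free //.
  by rewrite nki mul0r mulr0.
by rewrite !mxE !coord_free // nki !mulr0.
Qed.

Lemma tensor_ind U V (P : (U ⊗ V)%type -> Prop) :
  (forall u v, P (u ⊗ v)) -> (forall k s t, P s -> P t -> P (k *: s + t)) ->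
  forall t, P t.
Proof.
move=> Pp Pl t.
have P0 : P 0.
  by rewrite -(addNr ((0 : U) ⊗ (0 : V))) -scaleN1r; apply: Pl.
have PD s s' : P s -> P s' -> P (s + s').
  by move=> ps ps'; rewrite -[s]scale1r; apply: Pl.
rewrite [t]tensor_pureE; apply: big_ind => // i _; apply: big_ind => // j _.
by rewrite -[X in P X]addr0; apply: Pl.
Qed.

Lemma tensor_ext U V (W : lmodType K) (f g : {linear (U ⊗ V)%type -> W}) :
  (forall u v, f (u ⊗ v) = g (u ⊗ v)) -> f =1 g.
Proof. by move=> fg; elim/tensor_ind=> // k s t fs ft; rewrite !linearP fs ft. Qed.

End TensorTheory.

Section TensorMaps.
Variable K : fieldType.
Implicit Types U V W : vectType K.

(* f ⊗ g *)
Definition tmap U U' V V' (f : U -> U') (g : V -> V') :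
    (U ⊗ V)%type -> (U' ⊗ V')%type :=
  tlift (fun u v => f u ⊗ g v).

(* (U ⊗ V) ⊗ W -> U ⊗ (V ⊗ W) *)
Definition tassoc U V W : ((U ⊗ V) ⊗ W)%type -> (U ⊗ (V ⊗ W))%type :=
  tlift (fun t w => tlift (fun u v => u ⊗ (v ⊗ w)) t).

(* id ⊗ f and f ⊗ id for a linear form f, with U ⊗ K = U and K ⊗ V = V.        *)
Definition contr_r U V (f : V -> K) : (U ⊗ V)%type -> U :=
  tlift (fun u v => f v *: u).

Definition contr_l U V (f : U -> K) : (U ⊗ V)%type -> V :=
  tlift (fun u v => f u *: v).

End TensorMaps.

Section TensorAlgebra.
Variables (K : fieldType) (A B : fdAlgebra K).

Definition tensor_mul (x y : (A ⊗ B)%type) : (A ⊗ B)%type :=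
  tlift (fun a b => tlift (fun c d => (a ∗ c) ⊗ (b ∗ d)) y) x.

Let pure_linl (k : K) (u u' : A) (v : B) :
  (k *: u + u') ⊗ v = k *: (u ⊗ v) + u' ⊗ v.
Proof. exact: (pure_bilin A B).2. Qed.
Let pure_linr (k : K) (u : A) (v v' : B) :
  u ⊗ (k *: v + v') = k *: (u ⊗ v) + u ⊗ v'.
Proof. exact: (pure_bilin A B).1. Qed.

Let inner_bilin (a : A) (b : B) :
  bilin (fun c d => (a ∗ c) ⊗ (b ∗ d) : (A ⊗ B)%type).
Proof.
by split=> [c k d d'|d k c c']; rewrite amul_linr (pure_linl, pure_linr).
Qed.

Let outer_bilin y :
  bilin (fun a b => tlift (fun c d => (a ∗ c) ⊗ (b ∗ d) : (A ⊗ B)%type) y).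
Proof.
split=> [a k b b'|b k a a']; elim/tensor_ind: y => [c d|l s t Hs Ht].
- by rewrite !(tlift_pure _ _ (inner_bilin _ _)) amul_linl pure_linr.
- rewrite !tlift_is_linear Hs Ht !scalerDr !scalerA (mulrC l k).
  by rewrite addrACA.
- by rewrite !(tlift_pure _ _ (inner_bilin _ _)) amul_linl pure_linl.
- rewrite !tlift_is_linear Hs Ht !scalerDr !scalerA (mulrC l k).
  by rewrite addrACA.
Qed.

Lemma tensor_mul_pure (a c : A) (b d : B) :
  tensor_mul (a ⊗ b) (c ⊗ d) = (a ∗ c) ⊗ (b ∗ d).
Proof.
by rewrite /tensor_mul (tlift_pure _ _ (outer_bilin _)) (tlift_pure _ _ (inner_bilin _ _)).
Qed.

Fact tensor_mul_linl y : linear (tensor_mul^~ y).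
Proof. by move=> k s t; rewrite /tensor_mul linearP. Qed.

Fact tensor_mul_linr x : linear (tensor_mul x).
Proof.
move=> k s t; elim/tensor_ind: x => [a b|l x y Hx Hy].
  by rewrite /tensor_mul !(tlift_pure _ _ (outer_bilin _)) linearP.
rewrite !tensor_mul_linl Hx Hy !scalerDr !scalerA (mulrC l k).
by rewrite addrACA.
Qed.

Fact tensor_mulA : associative tensor_mul.
Proof.
move=> x y z; elim/tensor_ind: x => [a b|l s t Hs Ht]; last first.
  by rewrite !tensor_mul_linl Hs Ht.
elim/tensor_ind: y => [c d|l s t Hs Ht]; last first.
  by rewrite !(tensor_mul_linl, tensor_mul_linr) Hs Ht.
elim/tensor_ind: z => [e f|l s t Hs Ht]; last by rewrite !tensor_mul_linr Hs Ht.
by rewrite !tensor_mul_pure !amulA.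
Qed.

Fact tensor_mul1l : left_id (aone ⊗ aone) tensor_mul.
Proof.
elim/tensor_ind=> [a b|k s t Hs Ht]; first by rewrite tensor_mul_pure !amul1l.
by rewrite tensor_mul_linr Hs Ht.
Qed.

Fact tensor_mul1r : right_id (aone ⊗ aone) tensor_mul.
Proof.
elim/tensor_ind=> [a b|k s t Hs Ht]; first by rewrite tensor_mul_pure !amul1r.
by rewrite tensor_mul_linl Hs Ht.
Qed.

HB.instance Definition _ := Vector_isFdAlgebra.Build K (A ⊗ B)%type
  tensor_mulA tensor_mul1l tensor_mul1r tensor_mul_linl tensor_mul_linr.

End TensorAlgebra.

(* Identification of C a with C b when a = b in the group.                     *)
Definition transport (G : Type) (C : G -> Type) (a b : G) (e : a = b)
  (x : C a) : C b := eq_rect a C x b e.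

Arguments transport {G} C {a b} e x.

Section PiCoalgebra.
Variables (K : fieldType) (G : groupType) (C : G -> vectType K).
Variable Delta : forall a b : G, C (a * b)%g -> (C a ⊗ C b)%type.
Variable eps : C 1%g -> K.

Definition coassociative := forall (a b c : G) (x : C (a * b * c)%g),
  tassoc (tmap (@Delta a b) id (Delta x)) =
  tmap id (@Delta b c) (Delta (transport C (esym (mulgA a b c)) x)).

Definition counital := forall (a : G) (x : C a),
  contr_r eps (Delta (transport C (esym (mulg1 a)) x)) = x /\
  contr_l eps (Delta (transport C (esym (mul1g a)) x)) = x.

End PiCoalgebra.

Section Antipode.
Variables (K : fieldType) (G : groupType) (H : G -> fdAlgebra K).
Variable Delta : forall a b : G, H (a * b)%g -> (H a ⊗ H b)%type.
Variable eps : H 1%g -> K.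
Variable S : forall a : G, H a -> H (a^-1)%g.

Definition antipodal := forall (a : G) (x : H 1%g),
  tlift (fun u v => transport H (invgK a) (S u) ∗ v)
        (@Delta a^-1%g a (transport H (esym (mulVg a)) x)) = eps x *: aone /\
  tlift (fun u v => u ∗ transport H (invgK a) (S v))
        (@Delta a a^-1%g (transport H (esym (mulgV a)) x)) = eps x *: aone.

End Antipode.

Record hopfPiCoalgebra (K : fieldType) (G : groupType) := HopfPiCoalgebra {
  component :> G -> fdAlgebra K;
  comult : forall a b : G,
    {linear component (a * b)%g -> (component a ⊗ component b)%type};
  counit : {linear component 1%g -> K^o};
  antipode : forall a : G, {linear component a -> component (a^-1)%g};
  comult_coassoc : coassociative (fun a b => comult a b);
  comult_counit : counital (fun a b => comult a b) counit;
  comult_morph : forall a b, alg_morphism (comult a b);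
  counit_morph : alg_morphism counit;
  antipodeP : antipodal (fun a b => comult a b) counit (fun a => antipode a)
}.

(* The product of a possibly infinite family of spaces.                        *)
Definition pi_space (K : fieldType) (I : Type) (V : I -> lmodType K) :=
  forall i, V i.

Section ProductSpace.
Variables (K : fieldType) (I : Type) (V : I -> lmodType K).
Implicit Types f g h : pi_space V.

HB.instance Definition _ := gen_eqMixin (pi_space V).
HB.instance Definition _ := gen_choiceMixin (pi_space V).

Let dadd f g : pi_space V := fun i => f i + g i.
Let dopp f : pi_space V := fun i => - f i.
Let dscale (k : K) f : pi_space V := fun i => k *: f i.

Fact daddA : associative dadd.
Proof. by move=> f g h; apply: functional_extensionality_dep => i; rewrite /dadd addrA. Qed.
Fact daddC : commutative dadd.
Proof. by move=> f g; apply: functional_extensionality_dep => i; rewrite /dadd addrC. Qed.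
Fact dadd0 : left_id (fun=> 0) dadd.
Proof. by move=> f; apply: functional_extensionality_dep => i; rewrite /dadd add0r. Qed.
Fact daddN : left_inverse (fun=> 0) dopp dadd.
Proof. by move=> f; apply: functional_extensionality_dep => i; rewrite /dadd addNr. Qed.

HB.instance Definition _ :=
  GRing.isZmodule.Build (pi_space V) daddA daddC dadd0 daddN.

Fact dscaleA k l f : dscale k (dscale l f) = dscale (k * l) f.
Proof. by apply: functional_extensionality_dep => i; rewrite /dscale scalerA. Qed.
Fact dscale1 : left_id 1 dscale.
Proof. by move=> f; apply: functional_extensionality_dep => i; rewrite /dscale scale1r. Qed.
Fact dscaleDr : right_distributive dscale +%R.
Proof. by move=> k f g; apply: functional_extensionality_dep => i; rewrite /dscale scalerDr. Qed.
Fact dscaleDl f : {morph dscale^~ f : k l / k + l}.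
Proof. by move=> k l; apply: functional_extensionality_dep => i; rewrite /dscale scalerDl. Qed.

HB.instance Definition _ := GRing.Zmodule_isLmodule.Build K (pi_space V)
  dscaleA dscale1 dscaleDr dscaleDl.

Lemma pi_space_linE (k : K) f g i : (k *: f + g) i = k *: f i + g i.
Proof. by []. Qed.

End ProductSpace.

Section Integrals.
Variables (K : fieldType) (G : groupType) (H : hopfPiCoalgebra K G).

Definition form_family : lmodType K := pi_space (fun a : G => 'Hom(H a, K^o)).

Definition is_left_integral (lam : form_family) :=
  forall (a b : G) (x : H (a * b)%g),
    contr_r (lam b) (comult H a b x) = (lam (a * b)%g x : K) *: aone.

Definition is_right_integral (lam : form_family) :=
  forall (a b : G) (x : H (a * b)%g),
    contr_l (lam a) (comult H a b x) = (lam (a * b)%g x : K) *: aone.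

Definition left_integral : {pred form_family} :=
  fun lam => `[< is_left_integral lam >].
Definition right_integral : {pred form_family} :=
  fun lam => `[< is_right_integral lam >].

Let contr_r_lin a b (k : K) (f g : 'Hom(H b, K^o)) (t : (H a ⊗ H b)%type) :
  contr_r (k *: f + g) t = k *: contr_r f t + contr_r g t.
Proof.
rewrite /contr_r /tlift scaler_sumr -big_split; apply: eq_bigr => i _ /=.
rewrite scaler_sumr -big_split; apply: eq_bigr => j _ /=.
rewrite add_lfunE scale_lfunE scalerDl scalerDr -[k *: f _]/(k * f _).
by rewrite !scalerA mulrA (mulrC _ k).
Qed.

Let contr_l_lin a b (k : K) (f g : 'Hom(H a, K^o)) (t : (H a ⊗ H b)%type) :
  contr_l (k *: f + g) t = k *: contr_l f t + contr_l g t.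
Proof.
rewrite /contr_l /tlift scaler_sumr -big_split; apply: eq_bigr => i _ /=.
rewrite scaler_sumr -big_split; apply: eq_bigr => j _ /=.
rewrite add_lfunE scale_lfunE scalerDl scalerDr -[k *: f _]/(k * f _).
by rewrite !scalerA mulrA (mulrC _ k).
Qed.

Fact left_integral_submod : submod_closed left_integral.
Proof.
split=> [|k f g /asboolP Hf /asboolP Hg]; apply/asboolP => a b x.
  rewrite !lfunE /= scale0r /contr_r /tlift big1 // => i _.
  by rewrite big1 // => j _; rewrite lfunE /= scale0r scaler0.
rewrite !pi_space_linE contr_r_lin Hf Hg.
by rewrite add_lfunE scale_lfunE scalerDl scalerA.
Qed.

Fact right_integral_submod : submod_closed right_integral.
Proof.
split=> [|k f g /asboolP Hf /asboolP Hg]; apply/asboolP => a b x.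
  rewrite !lfunE /= scale0r /contr_l /tlift big1 // => i _.
  by rewrite big1 // => j _; rewrite lfunE /= scale0r scaler0.
rewrite !pi_space_linE contr_l_lin Hf Hg.
by rewrite add_lfunE scale_lfunE scalerDl scalerA.
Qed.

HB.instance Definition _ :=
  GRing.isSubmodClosed.Build K form_family left_integral left_integral_submod.
HB.instance Definition _ :=
  GRing.isSubmodClosed.Build K form_family right_integral right_integral_submod.

Record left_integrals := LeftIntegral {
  left_form :> form_family; _ : left_form \in left_integral }.

HB.instance Definition _ := [isSub for left_form].
HB.instance Definition _ := [Choice of left_integrals by <:].
HB.instance Definition _ := [SubChoice_isSubLmodule of left_integrals by <:].

Record right_integrals := RightIntegral {
  right_form :> form_family; _ : right_form \in right_integral }.

HB.instance Definition _ := [isSub for right_form].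
HB.instance Definition _ := [Choice of right_integrals by <:].
HB.instance Definition _ := [SubChoice_isSubLmodule of right_integrals by <:].

End Integrals.

Definition has_dimension (K : fieldType) (V : lmodType K) (n : nat) : Prop :=
  inhabited (Vector.axiom n V).

(* Main.v *)
Require Import Defs.
From mathcomp Require Import all_boot all_order all_algebra.
From mathcomp Require Import boolp.
From HB Require Import structures.

(* Write Q = S^2.  For a linear form p on H_1, the partial traces              *)
(*   lam_a(x) = Tr (y in H_a |-> (id ⊗ p) Delta_{a,1} (x Q(y)))                *)
(* form a left integral: since Q is comultiplicative and Q(y_2) S(y_1) =       *)
(* eps(y), one has x_1 ⊗ x_2 Q(y) = (x Q(y_2))_1 S(y_1) ⊗ (x Q(y_2))_2, and    *)
(* cyclicity of the trace moves S(y_1) next to the argument it cancels.  It is *)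
(* nonzero for some p, because summing lam_1(S(e_j)) over p = e^j, with (e_j)  *)
(* and (e^j) dual bases of H_1, gives the trace of                             *)
(* w |-> S(w_2) Q(w_1) = eps(w) 1.                                             *)
(* If lam is a left integral with lam_1 <> 0, then                             *)
(*   lam_1(u S(h_1)) h_2 = u_1 lam_{1/a}(u_2 S(h))    (u in H_1, h in H_a).    *)
(* This implies that h |-> lam_1(_ S(h)) is injective on H_1, hence onto its   *)
(* dual, and that every S_a is injective, hence bijective.  If mu is another   *)
(* left integral and mu_1 = lam_1(_ S(h)), the same identity gives             *)
(* h_1 ⊗ h_2 = h ⊗ 1, so that h is a scalar and mu_1 is a multiple of lam_1;   *)
(* and mu is determined by mu_1, as mu_a(x) 1 = x_1 mu_1(x_2).  Composition    *)
(* with the bijective antipode exchanges left and right integrals.             *)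

Set Implicit Arguments.
Unset Strict Implicit.
Unset Printing Implicit Defensive.

Import GRing.Theory.
Local Open Scope ring_scope.

(** * Linear maps, tensors and traces *)

(** Everything is decided in degree 1, where H_1 is an ordinary Hopf algebra, nonzero since eps(1) =
    1, whereas other components may vanish. Existence is [trace_form_integral], resting on
    [sw_mul_antipode2] and [trace_cyc], together with [trace_form_neq0]. Uniqueness rests on the
    Hopf-module identity [left_integral_antipode]: it makes the pairing lam_1(u S(h)) on H_1
    nondegenerate ([antipode_form_inj1]) and each S_a bijective ([antipode_inj], [antipode_surj]),
    which yields [left_integral_unique]. The right-handed case follows by composing forms with S
    ([right_integral_form_antipode], [left_integral_form_antipode]). *)

Section Linearity.
Variable K : fieldType.
Implicit Types U V W X : lmodType K.

Definition linear_of U V (f : U -> V) (fl : linear f) : {linear U -> V} :=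
  HB.pack f (GRing.isLinear.Build K U V _ f fl).

Lemma linear_scalable U V (f : U -> V) k x : linear f -> f (k *: x) = k *: f x.
Proof. by move=> fl; rewrite -[LHS]/(linear_of fl _) linearZ. Qed.

Lemma linear_id U : linear (fun x : U => x). Proof. by []. Qed.

Lemma linear_comp U V W (g : V -> W) (f : U -> V) :
  linear g -> linear f -> linear (fun x => g (f x)).
Proof. by move=> gl fl k x y; rewrite fl gl. Qed.

Lemma linear_app U V W (g : {linear V -> W}) (f : U -> V) :
  linear f -> linear (fun x => g (f x)).
Proof. by move=> fl k x y; rewrite fl linearP. Qed.

Lemma linear_scale U V (c : K) (f : U -> V) :
  linear f -> linear (fun x => c *: f x).
Proof. by move=> fl k x y; rewrite fl scalerDr !scalerA mulrC. Qed.

Lemma linear_scalel U V (f : U -> K^o) (v : V) :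
  linear f -> linear (fun x => (f x : K) *: v).
Proof. by move=> fl k x y; rewrite fl scalerDl -scalerA. Qed.

Lemma linear_amull U (A : fdAlgebra K) (f : U -> A) (a : A) :
  linear f -> linear (fun x => f x ∗ a).
Proof. by move=> fl k x y; rewrite fl amul_linl. Qed.

Lemma linear_amulr U (A : fdAlgebra K) (f : U -> A) (a : A) :
  linear f -> linear (fun x => a ∗ f x).
Proof. by move=> fl k x y; rewrite fl amul_linr. Qed.

Lemma linear_purer U (A B : vectType K) (f : U -> B) (a : A) :
  linear f -> linear (fun x => a ⊗ f x).
Proof. by move=> fl k x y; rewrite fl (pure_bilin A B).1. Qed.

Lemma linear_tlift_body U (A B : vectType K) W (f : U -> A -> B -> W) t :
  (forall a b, linear (fun x => f x a b)) -> linear (fun x => tlift (f x) t).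
Proof.
move=> fl k x y; rewrite /tlift scaler_sumr -big_split; apply: eq_bigr => i _ /=.
rewrite scaler_sumr -big_split; apply: eq_bigr => j _ /=.
by rewrite fl scalerDr !scalerA mulrC.
Qed.

Lemma linear_tlift U (A B : vectType K) W (f : A -> B -> W) (g : U -> (A ⊗ B)%type) :
  linear g -> linear (fun x => tlift f (g x)).
Proof. by move=> gl k x y; rewrite gl tlift_is_linear. Qed.

End Linearity.

Section Tlift.
Variable K : fieldType.
Implicit Types (U V A B : vectType K) (W : lmodType K).

Lemma eq_tlift U V W (f g : U -> V -> W) t :
  (forall u v, f u v = g u v) -> tlift f t = tlift g t.
Proof. by move=> fg; apply: eq_bigr => i _; apply: eq_bigr => j _; rewrite fg. Qed.

Lemma tlift_comp U V W (X : lmodType K) (h : W -> X) (f : U -> V -> W) t :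
  linear h -> h (tlift f t) = tlift (fun u v => h (f u v)) t.
Proof.
move=> hl; rewrite -[h _]/(linear_of hl _) linear_sum.
by apply: eq_bigr => i _; rewrite linear_sum; apply: eq_bigr => j _; rewrite linearZ.
Qed.

Lemma exchange_tlift U V A B W (f : U -> V -> A -> B -> W) s t :
  tlift (fun u v => tlift (fun a b => f u v a b) t) s =
  tlift (fun a b => tlift (fun u v => f u v a b) s) t.
Proof.
rewrite [LHS]/tlift.
under eq_bigr => i _ do under eq_bigr => j _ do rewrite scaler_sumr.
under eq_bigr => i _ do rewrite exchange_big /=.
rewrite exchange_big /=; apply: eq_bigr => k _.
under eq_bigr => i _ do under eq_bigr => j _ do rewrite scaler_sumr.
under eq_bigr => i _ do rewrite exchange_big /=.
rewrite exchange_big /=; apply: eq_bigr => l _.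
rewrite scaler_sumr; apply: eq_bigr => i _.
rewrite scaler_sumr; apply: eq_bigr => j _.
by rewrite !scalerA mulrC.
Qed.

Lemma tlift_tmap U V A B W (h : U -> A) (g : V -> B) (f : A -> B -> W) t :
  bilin f -> tlift f (tmap h g t) = tlift (fun u v => f (h u) (g v)) t.
Proof.
move=> fb; rewrite (tlift_comp _ _ (tlift_is_linear f)).
by apply: eq_tlift => u v; rewrite tlift_pure.
Qed.

Lemma tlift0 U V W (t : (U ⊗ V)%type) : tlift (fun _ _ => 0 : W) t = 0.
Proof. by rewrite /tlift big1 // => i _; rewrite big1 // => j _; rewrite scaler0. Qed.

Lemma eq_tlift_basis U V W (f g : U -> V -> W) t :
  (forall (i : 'I_(\dim {:U})) (j : 'I_(\dim {:V})), f (vbasis {:U})`_i (vbasis {:V})`_j =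
               g (vbasis {:U})`_i (vbasis {:V})`_j) ->
  tlift f t = tlift g t.
Proof. by move=> fg; apply: eq_bigr => i _; apply: eq_bigr => j _; rewrite fg. Qed.

Lemma coord_vbasisE U (i j : 'I_(\dim {:U})) :
  coord (vbasis {:U}) i (vbasis {:U})`_j = (i == j)%:R.
Proof. by rewrite coord_free ?(basis_free (vbasisP _)) // eq_sym. Qed.

Lemma tlift_vbasis_l U V W (f : U -> V -> W) (i : 'I_(\dim {:U})) v :
  (forall u, linear (f u)) -> tlift f ((vbasis {:U})`_i ⊗ v) = f (vbasis {:U})`_i v.
Proof.
move=> fl; rewrite /tlift (bigD1 i) //= [X in _ + X]big1 ?addr0 => [|k /negPf ki].
  rewrite [v in RHS](coord_vbasis (memvf v)) -[RHS]/(linear_of (fl _) _) linear_sum.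
  by apply: eq_bigr => j _; rewrite linearZ /= mxE coord_vbasisE eqxx mul1r.
by apply: big1 => j _; rewrite mxE coord_vbasisE ki mul0r scale0r.
Qed.

Lemma tlift_vbasis U V W (f : U -> V -> W) (i : 'I_(\dim {:U})) (j : 'I_(\dim {:V})) :
  tlift f ((vbasis {:U})`_i ⊗ (vbasis {:V})`_j) = f (vbasis {:U})`_i (vbasis {:V})`_j.
Proof.
rewrite /tlift (bigD1 i) //= [X in _ + X]big1 ?addr0 => [|k /negPf ki].
  rewrite (bigD1 j) //= [X in _ + X]big1 ?addr0 => [|k /negPf kj].
    by rewrite mxE !coord_vbasisE !eqxx mulr1 scale1r.
  by rewrite mxE !coord_vbasisE kj mulr0 scale0r.
by apply: big1 => l _; rewrite mxE coord_vbasisE ki mul0r scale0r.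
Qed.

(* [f] need not be linear: [tlift] evaluates it on basis vectors only, so    *)
(* that coassociativity below holds for arbitrary [f] as well.               *)
Lemma tlift_tassoc U V A (X : vectType K) W
    (h : X -> (U ⊗ V)%type) (f : U -> V -> A -> W)
    (t : (X ⊗ A)%type) : linear h ->
  tlift (fun u r => tlift (f u) r) (tassoc (tmap h id t)) =
  tlift (fun x a => tlift (fun u v => f u v a) (h x)) t.
Proof.
move=> hl; rewrite /tassoc tlift_tmap; last first.
  split=> [s|a]; last exact: tlift_is_linear.
  apply: linear_tlift_body => u v; apply: linear_purer; apply: linear_purer.
  exact: linear_id.
rewrite (tlift_comp _ _ (tlift_is_linear _)); apply: eq_tlift_basis => i j.
rewrite (tlift_comp _ _ (tlift_is_linear _)); apply: eq_tlift_basis => k l.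
by rewrite tlift_vbasis_l ?tlift_vbasis // => u; apply: tlift_is_linear.
Qed.

Lemma tlift_tmap_r U V A (X : vectType K) W
    (h : X -> (V ⊗ A)%type) (f : U -> V -> A -> W)
    (t : (U ⊗ X)%type) :
  tlift (fun u r => tlift (f u) r) (tmap id h t) =
  tlift (fun u x => tlift (f u) (h x)) t.
Proof.
rewrite (tlift_comp _ _ (tlift_is_linear _)); apply: eq_tlift_basis => i j.
by rewrite tlift_vbasis_l // => u; apply: tlift_is_linear.
Qed.

End Tlift.

(** * Traces, dual bases and injective linear maps *)

Section LinearAlgebra.
Variable K : fieldType.
Implicit Types U V : vectType K.

(** Meant for linear [F], but taken on bare functions so that Sweedler expressions need not be
    bundled as linear maps. *)
Definition trace V (F : V -> V) : K^o :=
  \sum_i coord (vbasis {:V}) i (F (vbasis {:V})`_i).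

Lemma eq_trace V (F F' : V -> V) : F =1 F' -> trace F = trace F'.
Proof. by move=> FF'; apply: eq_bigr => i _; rewrite FF'. Qed.

Lemma trace_scale V (k : K) (F : V -> V) : trace (fun x => k *: F x) = k *: trace F.
Proof. by rewrite scaler_sumr; apply: eq_bigr => i _; rewrite linearZ. Qed.

Lemma linear_trace (U : lmodType K) V (F : U -> V -> V) :
  (forall v, linear (F^~ v)) -> linear (fun u => trace (F u)).
Proof.
move=> Fl k x y; rewrite /trace scaler_sumr -big_split; apply: eq_bigr => i _.
by rewrite Fl linearP.
Qed.

Lemma trace_tlift (U W : vectType K) V (f : U -> W -> V -> V) t :
  trace (fun v => tlift (fun u w => f u w v) t) =
  tlift (fun u w => trace (f u w)) t.
Proof.
rewrite /trace /tlift.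
under eq_bigr => i _ do rewrite linear_sum.
rewrite exchange_big; apply: eq_bigr => j _ /=.
under eq_bigr => i _ do rewrite linear_sum.
rewrite exchange_big; apply: eq_bigr => k _ /=.
by rewrite scaler_sumr; apply: eq_bigr => i _; rewrite linearZ.
Qed.

(* Cyclicity of the trace, in the presence of auxiliary tensor factors. *)
Lemma trace_cyc V (A B W : vectType K) (D : V -> (A ⊗ W)%type)
    (D' : W -> (B ⊗ V)%type) (F : W -> W) (h : B -> A -> K) :
  linear D -> linear D' ->
  trace (fun y => tlift (fun a w => tlift (fun b v => h b a *: v) (D' (F w))) (D y)) =
  trace (fun w => tlift (fun b v => tlift (fun a w' => h b a *: F w') (D v)) (D' w)).
Proof.
move=> Dl Dl'.
pose e (X : vectType K) (i : 'I_(\dim {:X})) := (vbasis {:X})`_i.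
transitivity (\sum_v \sum_a \sum_w \sum_b
    D (e V v) a w * D' (F (e W w)) b v *
    h (e B b) (e A a)).
  apply: eq_bigr => v _; rewrite linear_sum; apply: eq_bigr => a _ /=.
  rewrite linear_sum; apply: eq_bigr => w _ /=.
  rewrite linearZ /= linear_sum mulr_sumr; apply: eq_bigr => b _ /=.
  rewrite linear_sum (bigD1 v) //= big1 ?addr0 => [|u /negPf uv].
    by rewrite !linearZ /= coord_vbasisE eqxx mulr1 mulrA.
  by rewrite !linearZ /= coord_vbasisE eq_sym uv !mulr0.
(* Expanding F(e_w) in the basis of [W] creates the index w', over which the trace on the right-hand
   side is taken. *)
transitivity (\sum_v \sum_a \sum_w \sum_b \sum_w'
    D (e V v) a w * (coord (vbasis fullv) w' (F (e W w)) *
     D' (e W w') b v) * h (e B b) (e A a)).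
  apply: eq_bigr => v _; apply: eq_bigr => a _; apply: eq_bigr => w _.
  apply: eq_bigr => b _; rewrite [F _](coord_vbasis (memvf _)).
  rewrite -[D' _]/(linear_of Dl' _) linear_sum summxE mulr_sumr mulr_suml.
  apply: eq_bigr => w' _; rewrite linearZ /= mxE -(coord_vbasis (memvf _)) //.
transitivity (\sum_w' \sum_b \sum_v \sum_a \sum_w
    D (e V v) a w * (coord (vbasis fullv) w' (F (e W w)) *
     D' (e W w') b v) * h (e B b) (e A a)).
  symmetry; rewrite exchange_big /=.
  under eq_bigr => b _ do rewrite exchange_big.
  under eq_bigr => b _ do under eq_bigr => v _ do rewrite exchange_big.
  under eq_bigr => b _ do under eq_bigr => v _ do under eq_bigr => a _ do
    rewrite exchange_big.
  rewrite exchange_big; apply: eq_bigr => v _; rewrite exchange_big.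
  by apply: eq_bigr => a _; rewrite exchange_big.
apply: eq_bigr => w' _; rewrite linear_sum; apply: eq_bigr => b _ /=.
rewrite linear_sum; apply: eq_bigr => v _ /=.
rewrite linearZ /= linear_sum mulr_sumr; apply: eq_bigr => a _ /=.
rewrite linear_sum mulr_sumr; apply: eq_bigr => w _ /=.
rewrite !linearZ /=.
rewrite [RHS]mulrCA -[LHS]mulrA; congr (_ * _).
by rewrite -mulrA mulrC -mulrA.
Qed.

Lemma vect_ext V (u v : V) :
  (forall i, coord (vbasis {:V}) i u = coord (vbasis {:V}) i v) -> u = v.
Proof.
move=> uv; rewrite (coord_vbasis (memvf u)) (coord_vbasis (memvf v)).
by apply: eq_bigr => i _; rewrite uv.
Qed.

Lemma trace_rank1 V (f : V -> K^o) v : linear f -> trace (fun x => (f x : K) *: v) = f v.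
Proof.
move=> fl; rewrite /trace [v in RHS](coord_vbasis (memvf v)).
rewrite -[RHS]/(linear_of fl _) linear_sum; apply: eq_bigr => i _.
by rewrite !linearZ /= mulrC.
Qed.

Lemma coord_contr U V (t : (U ⊗ V)%type) i j :
  coord (vbasis {:U}) i (tlift (fun u v => coord (vbasis {:V}) j v *: u) t) = t i j.
Proof.
rewrite linear_sum (bigD1 i) //= [X in _ + X]big1 ?addr0 => [|k /negPf ki].
  rewrite linear_sum (bigD1 j) //= [X in _ + X]big1 ?addr0 => [|k /negPf kj].
    by rewrite !linearZ /= !coord_vbasisE !eqxx !mulr1.
  by rewrite !linearZ /= !coord_vbasisE eq_sym kj mul0r mulr0.
rewrite linear_sum big1 // => l _.
by rewrite !linearZ /= !coord_vbasisE (eq_sym i) ki !mulr0.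
Qed.

(** This is Tr(D B) = Tr(B D), with [B] seen as a map V ⊗ V -> V: the left side is the trace on V ⊗
    V, the right side the trace on V. *)
Lemma trace_comult V (D : V -> (V ⊗ V)%type) (B : V -> V -> V) : linear D ->
  \sum_j trace (fun x =>
    tlift (fun u v => coord (vbasis {:V}) j v *: u) (D (B x (vbasis {:V})`_j))) =
  trace (fun x => tlift B (D x)).
Proof.
move=> Dl; rewrite exchange_big /=.
pose e (i : 'I_(\dim {:V})) := (vbasis {:V})`_i.
transitivity (\sum_i \sum_j \sum_k coord (vbasis {:V}) k (B (e i) (e j)) * D (e k) i j).
  apply: eq_bigr => i _; apply: eq_bigr => j _; rewrite coord_contr.
  rewrite [B _ _](coord_vbasis (memvf _)) -[D _]/(linear_of Dl _) linear_sum summxE.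
  by apply: eq_bigr => k _; rewrite linearZ /= mxE -(coord_vbasis (memvf _)).
under eq_bigr => i _ do rewrite exchange_big.
rewrite exchange_big; apply: eq_bigr => k _ /=.
rewrite linear_sum; apply: eq_bigr => i _; rewrite linear_sum.
by apply: eq_bigr => j _; rewrite linearZ /= mulrC.
Qed.

(** Amounts to t = sum_j t_j ⊗ e_j, where t_j contracts t with the j-th coordinate form. *)
Lemma tlift_coord U V (W : lmodType K) (f : U -> V -> W) t : bilin f ->
  tlift f t = \sum_j f (tlift (fun u v => coord (vbasis {:V}) j v *: u) t) (vbasis {:V})`_j.
Proof.
move=> fb; under [RHS]eq_bigr => j _ do rewrite (tlift_comp _ _ (fb.2 _)).
rewrite /tlift [RHS]exchange_big; apply: eq_bigr => i _ /=.
rewrite [RHS]exchange_big; apply: eq_bigr => k _ /=.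
rewrite (bigD1 k) //= [X in _ + X]big1 ?addr0 => [|j /negPf kj].
  by rewrite coord_vbasisE eqxx scale1r.
rewrite -[f _ _]/(linear_of (fb.2 _) _) linearZ /= coord_vbasisE kj.
by rewrite scale0r scaler0.
Qed.

Lemma linear_inj_dim U V (f : U -> V) : linear f -> (forall u, f u = 0 -> u = 0) ->
  (\dim {:U} <= \dim {:V})%N.
Proof.
move=> fl f0; rewrite -(@limg_dim_eq _ _ _ (linfun (linear_of fl)) fullv).
  exact/dimvS/subvf.
apply/eqP; rewrite -subv0; apply/subvP => u; rewrite memv_cap memv_ker lfunE /=.
by case/andP => _ /eqP /f0 ->; rewrite mem0v.
Qed.

Lemma linear_inj_surj U V (f : U -> V) : linear f -> (forall u, f u = 0 -> u = 0) ->
  (\dim {:V} <= \dim {:U})%N -> forall v, exists u, f u = v.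
Proof.
move=> fl f0 dVU v; pose F := linfun (linear_of fl).
have /eqP limgF : (F @: fullv)%VS == fullv.
  rewrite eqEdim subvf limg_dim_eq //.
  apply/eqP; rewrite -subv0; apply/subvP => u; rewrite memv_cap memv_ker lfunE /=.
  by case/andP => _ /eqP /f0 ->; rewrite mem0v.
have /memv_imgP [u _ ->] : v \in (F @: fullv)%VS by rewrite limgF memvf.
by exists u; rewrite lfunE.
Qed.

End LinearAlgebra.

(** * Sweedler calculus and the antipode *)

Section Sweedler.
Variables (K : fieldType) (G : groupType) (H : hopfPiCoalgebra K G).
Implicit Types (a b c : G) (W : lmodType K).

Local Notation eps x := (counit H x : K).

Definition cast a c (x : H a) : H c :=
  if a =P c is ReflectT e then transport (component H) e x else 0.

(** Equality on [G] is decidable, so its proofs are unique and the choice of [e] is immaterial. *)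
Lemma castE a c (e : a = c) (x : H a) : cast c x = transport (component H) e x.
Proof. by rewrite /cast; case: eqP => // e'; rewrite (eq_irrelevance e e'). Qed.

Lemma cast_id a (x : H a) : cast a x = x.
Proof. by rewrite (castE erefl). Qed.

Lemma linear_cast (U : lmodType K) a c (f : U -> H a) :
  linear f -> linear (fun x => cast c (f x)).
Proof.
move=> fl; rewrite /cast; case: eqP => [e|ne] k x y; last by rewrite scaler0 addr0.
by rewrite fl; case: _ / e.
Qed.

(* [sw B x] is the Sweedler sum of the B(x_(1), x_(2)).  Degrees are read off  *)
(* from the types, and mismatched ones give 0, so that no group equation       *)
(* appears in the terms.                                                       *)
Definition sw a b c W (B : H a -> H b -> W) (x : H c) : W :=
  tlift B (comult H a b (cast (a * b)%g x)).

Definition S a c (x : H a) : H c := cast c (antipode H a x).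

Lemma linear_S (U : lmodType K) a c (f : U -> H a) :
  linear f -> linear (fun x => S c (f x)).
Proof. by move=> fl; apply/linear_cast/linear_app. Qed.

Definition antipode2 a (x : H a) : H a := S a (S (a^-1)%g x).
Lemma linear_antipode2 (U : lmodType K) a (f : U -> H a) :
  linear f -> linear (fun x => antipode2 (f x)).
Proof. by move=> fl; apply/linear_S/linear_S. Qed.

Lemma linear_sw (U : lmodType K) a b c W (B : H a -> H b -> W) (f : U -> H c) :
  linear f -> linear (fun x => sw B (f x)).
Proof. by move=> fl; apply: linear_tlift; apply/linear_app/linear_cast. Qed.

Lemma linear_sw_body (U : lmodType K) a b c W (B : U -> H a -> H b -> W) (x : H c) :
  (forall u v, linear (fun z => B z u v)) -> linear (fun z => sw (B z) x).
Proof. exact: linear_tlift_body. Qed.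

Lemma eq_sw a b c W (B B' : H a -> H b -> W) (x : H c) :
  (forall u v, B u v = B' u v) -> sw B x = sw B' x.
Proof. exact: eq_tlift. Qed.

Lemma sw_comp a b c W (X : lmodType K) (h : W -> X) (B : H a -> H b -> W) (x : H c) :
  linear h -> h (sw B x) = sw (fun u v => h (B u v)) x.
Proof. exact: tlift_comp. Qed.

Lemma exchange_sw a b c a' b' c' W (B : H a -> H b -> H a' -> H b' -> W)
    (x : H c) (y : H c') :
  sw (fun u v => sw (fun s t => B u v s t) y) x =
  sw (fun s t => sw (fun u v => B u v s t) x) y.
Proof. exact: exchange_tlift. Qed.

(** The composite degrees are variables tied by equations, so that the rule rewrites terms whose
    degrees agree only up to group identities; [grp] discharges these. *)
Lemma sw_coassoc a b c ab bc abc W (B : H a -> H b -> H c -> W) (x : H abc) :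
  ab = (a * b)%g -> bc = (b * c)%g -> abc = (a * b * c)%g ->
  sw (fun (u : H ab) w => sw (fun s t => B s t w) u) x =
  sw (fun s (u : H bc) => sw (fun t w => B s t w) u) x.
Proof.
move=> eab ebc eabc; subst; rewrite /sw cast_id.
have Dl : linear (fun u : H (a * b)%g => comult H a b (cast (a * b)%g u)).
  by apply/linear_app/linear_cast/linear_id.
rewrite -(tlift_tassoc B _ Dl).
rewrite -[RHS](tlift_tmap_r (fun u => comult H b c (cast (b * c)%g u)) B).
congr tlift.
rewrite (castE (esym (mulgA a b c))).
have -> : (fun u => comult H a b (cast (a * b)%g u)) = comult H a b.
  by apply: funext => u; rewrite cast_id.
have -> : (fun u => comult H b c (cast (b * c)%g u)) = comult H b c.
  by apply: funext => u; rewrite cast_id.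
exact: comult_coassoc.
Qed.

Lemma sw_counitr a W (B : H a -> W) (x : H a) :
  linear B -> sw (fun u (v : H 1%g) => eps v *: B u) x = B x.
Proof.
move=> Bl; rewrite -[in RHS](comult_counit x).1 /contr_r tlift_comp //.
rewrite /sw (castE (esym (mulg1 a))); apply: eq_tlift => u v.
by rewrite -[B (_ *: _)]/(linear_of Bl _) linearZ.
Qed.

Lemma sw_counitl a W (B : H a -> W) (x : H a) :
  linear B -> sw (fun (u : H 1%g) v => eps u *: B v) x = B x.
Proof.
move=> Bl; rewrite -[in RHS](comult_counit x).2 /contr_l tlift_comp //.
rewrite /sw (castE (esym (mul1g a))); apply: eq_tlift => u v.
by rewrite -[B (_ *: _)]/(linear_of Bl _) linearZ.
Qed.

(** The linear [F] is the surrounding expression, so that the axiom can be used deep inside a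
    Sweedler sum. *)
Lemma sw_antipodel a a' W (F : H a -> W) (x : H 1%g) :
  linear F -> a' = (a^-1)%g ->
  sw (fun (u : H a') v => F (S a u ∗ v)) x = eps x *: F aone.
Proof.
move=> Fl ->; rewrite /sw (castE (esym (mulVg a))).
have /(congr1 F) := (antipodeP a x).1.
rewrite -[F (_ *: _)]/(linear_of Fl _) linearZ /= => <-.
rewrite tlift_comp //; apply: eq_tlift => u v.
by rewrite /S (castE (invgK a)).
Qed.

Lemma sw_antipoder a a' W (F : H a -> W) (x : H 1%g) :
  linear F -> a' = (a^-1)%g ->
  sw (fun u (v : H a') => F (u ∗ S a v)) x = eps x *: F aone.
Proof.
move=> Fl ->; rewrite /sw (castE (esym (mulgV a))).
have /(congr1 F) := (antipodeP a x).2.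
rewrite -[F (_ *: _)]/(linear_of Fl _) linearZ /= => <-.
rewrite tlift_comp //; apply: eq_tlift => u v.
by rewrite /S (castE (invgK a)).
Qed.

Lemma sw_one a b c W (B : H a -> H b -> W) :
  bilin B -> c = (a * b)%g -> sw B (aone : H c) = B aone aone.
Proof.
move=> Bb ->; rewrite /sw cast_id.
by case: (comult_morph H a b) => _ -> _; rewrite tlift_pure.
Qed.

Lemma sw_mul a b c W (B : H a -> H b -> W) (x y : H c) :
  bilin B -> c = (a * b)%g ->
  sw B (x ∗ y) = sw (fun u v => sw (fun s t => B (u ∗ s) (v ∗ t)) y) x.
Proof.
move=> Bb e; subst c; rewrite /sw !cast_id.
case: (comult_morph H a b) => _ _ ->.
rewrite [_ ∗ _]/(tensor_mul _ _) /tensor_mul tlift_comp; last exact: tlift_is_linear.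
apply: eq_tlift => u v; rewrite tlift_comp; last exact: tlift_is_linear.
by apply: eq_tlift => s t; rewrite tlift_pure.
Qed.


End Sweedler.

Arguments S {K G H a} c x.
Ltac lin := intros; repeat first
  [ exact: linear_id | assumption
  | match goal with
    | H : bilin ?f |- linear (?f _) => exact: H.1
    | H : bilin ?f |- linear (fun x => ?f _ x) => exact: H.1
    | H : bilin ?f |- linear (fun x => ?f x _) => exact: H.2
    | H : bilin ?f |- linear (fun x => ?f _ (@?g x)) =>
        apply: (linear_comp (H.1 _) (f := g))
    | H : bilin ?f |- linear (fun x => ?f (@?g x) ?y) =>
        apply: (linear_comp (H.2 y) (f := g))
    | H : linear ?f |- linear (fun x => ?f (@?g x)) =>
        apply: (linear_comp H (f := g))
    | |- bilin _ => split=> ?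
    end
  | apply: linear_S | apply: linear_antipode2 | apply: linear_cast | apply: linear_sw
  | apply: linear_sw_body => ? ?
  | apply: linear_amull | apply: linear_amulr
  | apply: linear_scale | apply: linear_scalel
  | apply: linear_app ].

Ltac grp := subst; rewrite ?(invgM, invgK, invg1) -?mulgA;
  by rewrite ?(mulKg, mulVKg, mulgV, mulVg, mulg1, mul1g).

(** * Comultiplication of S and of its square *)

Section Antipode.
Variables (K : fieldType) (G : groupType) (H : hopfPiCoalgebra K G).
Implicit Types (a b c : G) (W : lmodType K).

Local Notation eps x := (counit H x : K).

Lemma antipode_one a c : c = (a^-1)%g -> S c (aone : H a) = aone.
Proof.
move=> e; have e1 : eps aone = 1 by case: (counit_morph H).
have := @sw_antipodel K G H c a _ id aone (@linear_id _ _).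
rewrite e1 scale1r sw_one ?amul1r; [by apply; grp|lin|grp].
Qed.

Lemma counit_antipode (x : H 1%g) : eps (S 1%g x) = eps x.
Proof.
have [el e1 eM] := counit_morph H.
pose E (x : H 1%g) : K^o := counit H x.
have El : linear E by lin.
have := @sw_antipodel K G H 1%g 1%g _ E x El (esym (invg1 _)).
rewrite /E e1 -[_ *: _]/(_ * 1) mulr1 => <-.
rewrite -[counit H _]/(E _) -(sw_counitr (B := fun x => E (S 1%g x)) x); last by lin.
by apply: (@eq_sw K G H _ _ _ K^o) => u v; rewrite /E eM -[_ ∗ _]/(_ * _) -[_ *: _]/(_ * _) mulrC.
Qed.

(** Says that v |-> S(v_2) ⊗ S(v_1) is a right convolution inverse of Delta: the inner factors u_2
    S(v_1) cancel, then u_1 S(v_2). *)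
Lemma sw_comult_antipode a b c c' a' b' W (B : H b' -> H a' -> W) (y : H 1%g) :
  bilin B -> c = (a * b)%g -> c' = (c^-1)%g -> a' = (a^-1)%g -> b' = (b^-1)%g ->
  sw (fun (u : H c') (v : H c) => sw (fun u1 u2 =>
    sw (fun (v1 : H a) (v2 : H b) => B (u1 ∗ S b' v2) (u2 ∗ S a' v1)) v) u) y =
  eps y *: B aone aone.
Proof.
move=> Bb ec ec' ea' eb'.
rewrite (sw_coassoc (bc := b)); try grp.
under eq_sw => u1 r.
  rewrite -(sw_coassoc (ab := 1%g)); try grp.
  under eq_sw => q v2.
    rewrite (sw_antipoder (F := fun z => B (u1 ∗ S b' v2) z)); [|lin|grp].
  over.
  rewrite (sw_counitl (B := fun z => B (u1 ∗ S b' z) aone)); last by lin.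
over.
by rewrite (sw_antipoder (F := fun z => B z aone)); [|lin|grp].
Qed.

(** Uniqueness of convolution inverses: Delta S is a left inverse of Delta because Delta is
    multiplicative, and x |-> S(x_2) ⊗ S(x_1) is a right inverse. *)
Lemma sw_antipode a b c c' a' b' W (B : H b' -> H a' -> W) (x : H c) :
  bilin B -> c = (a * b)%g -> c' = (c^-1)%g -> a' = (a^-1)%g -> b' = (b^-1)%g ->
  sw B (S c' x) = sw (fun (x1 : H a) (x2 : H b) => B (S b' x2) (S a' x1)) x.
Proof.
move=> Bb ec ec' ea' eb'.
rewrite -(sw_counitr (B := fun x => sw B (S c' x)) x); last by lin.
(* [Phi w v] is [B] evaluated on Delta(w) (S(v_2) ⊗ S(v_1)). The triple product Delta(S(x_1) x_2)
   (S(x_4) ⊗ S(x_3)) is computed in its two groupings. *)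
pose Phi (w : H c') (v : H c) := sw (fun (v1 : H a) (v2 : H b) =>
  sw (fun p q => B (p ∗ S b' v2) (q ∗ S a' v1)) w) v.
transitivity (sw (fun (x1 : H c) (y : H 1%g) =>
    sw (fun (u : H c') (v : H c) => Phi (S c' x1 ∗ u) v) y) x).
  apply: eq_sw => x1 y.
  have sl : linear (fun w : W => eps y *: w) by lin.
  rewrite [LHS](sw_comp _ _ sl).
  under eq_sw => z1 z2.
    have Bz : bilin (fun p q => B (z1 ∗ p) (z2 ∗ q)) by lin.
    have -> : B z1 z2 = B (z1 ∗ aone) (z2 ∗ aone) by rewrite !amul1r.
    rewrite -[_ *: _](sw_comult_antipode y Bz ec ec' ea' eb').
  over.
  rewrite exchange_sw; apply: eq_sw => u v.
  under eq_sw => z1 z2 do rewrite exchange_sw.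
  rewrite exchange_sw; apply: eq_sw => v1 v2.
  rewrite sw_mul; [|lin|grp].
  by apply: eq_sw => z1 z2; apply: eq_sw => u1 u2; rewrite !amulA.
rewrite -(sw_coassoc (ab := 1%g)); try grp.
under eq_sw => r v.
  rewrite (sw_antipodel (F := fun z => Phi z v)); [|by rewrite /Phi; lin|grp].
over.
rewrite (sw_counitl (B := Phi aone)); last by rewrite /Phi; lin.
apply: eq_sw => v1 v2.
by rewrite sw_one ?amul1l //; [lin|grp].
Qed.

Local Notation Q := antipode2.

Lemma sw_antipode2 a b c W (B : H a -> H b -> W) (x : H c) :
  bilin B -> c = (a * b)%g ->
  sw B (Q x) = sw (fun (x1 : H a) (x2 : H b) => B (Q x1) (Q x2)) x.
Proof.
move=> Bb ec; rewrite /Q (sw_antipode (a := (b^-1)%g) (b := (a^-1)%g)); try grp.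
by rewrite (sw_antipode (a := a) (b := b)) //; lin.
Qed.

(** The antipode axiom at the element S(y), whose comultiplication is S(y_2) ⊗ S(y_1). *)
Lemma sw_antipode2_antipode a a' W (F : H a -> W) (y : H 1%g) :
  linear F -> a' = (a^-1)%g ->
  sw (fun (y1 : H a') (y2 : H a) => F (Q y2 ∗ S a y1)) y = eps y *: F aone.
Proof.
move=> Fl e; subst a'; rewrite -(counit_antipode y) -(sw_antipodel _ Fl erefl).
rewrite (sw_antipode (a := (a^-1)%g) (b := a)) //; try grp.
lin.
Qed.

Lemma sw_antipode_antipode2 a a' W (F : H a -> W) (y : H 1%g) :
  linear F -> a' = (a^-1)%g ->
  sw (fun (y1 : H a) (y2 : H a') => F (S a y2 ∗ Q y1)) y = eps y *: F aone.
Proof.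
move=> Fl e; subst a'; rewrite -(counit_antipode y) -(sw_antipoder _ Fl erefl).
rewrite (sw_antipode (a := a) (b := (a^-1)%g)) //; try grp.
lin.
Qed.

End Antipode.

(** * Integrals *)

Section LeftIntegral.
Variables (K : fieldType) (G : groupType) (H : hopfPiCoalgebra K G).
Implicit Types (a b c : G) (W : lmodType K).

Local Notation eps x := (counit H x : K).
Local Notation Q := antipode2.

(** From right to left: Delta(x Q(y_2)) splits as x_1 Q(y_2) ⊗ x_2 Q(y_3), and Q(y_2) S(y_1)
    cancels. *)
Lemma sw_mul_antipode2 a b c a' W (B : H a -> H b -> W) (x : H c) (y : H b) :
  bilin B -> c = (a * b)%g -> a' = (a^-1)%g ->
  sw (fun x1 x2 => B x1 (x2 ∗ Q y)) x =
  sw (fun (y1 : H a') (y2 : H c) =>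
    sw (fun s t => B (s ∗ S a y1) t) (x ∗ Q y2)) y.
Proof.
move=> Bb ec ea'; symmetry.
under eq_sw => y1 y2.
  rewrite sw_mul; [|lin|grp].
  under eq_sw => x1 x2.
    rewrite (sw_antipode2 (a := a) (b := b)) //; last by lin.
    under eq_sw => u v do rewrite -amulA.
  over.
over.
rewrite exchange_sw; apply: eq_sw => x1 x2.
rewrite -(sw_coassoc (ab := 1%g)); try grp.
under eq_sw => u v.
  rewrite (sw_antipode2_antipode (F := fun z => B (x1 ∗ z) (x2 ∗ Q v)));
    [|lin|grp].
over.
rewrite (sw_counitl (B := fun v => B (x1 ∗ aone) (x2 ∗ Q v))) ?amul1r //.
lin.
Qed.

Definition contr_form (p : H 1%g -> K) a (x : H a) : H a :=
  sw (fun u (v : H 1%g) => p v *: u) x.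

Lemma linear_contr_form (U : lmodType K) p a (f : U -> H a) :
  linear f -> linear (fun x => contr_form p (f x)).
Proof. exact: linear_sw. Qed.

Lemma sw_contr_form p a b c W (B : H a -> H b -> W) (x : H c) :
  bilin B -> c = (a * b)%g ->
  sw B (contr_form p x) = sw (fun s t => B s (contr_form p t)) x.
Proof.
move=> Bb ec; rewrite /contr_form.
have Bl : linear (fun u : H c => sw B u) by lin.
rewrite [LHS](sw_comp _ _ Bl).
have Bs (k : K) (u : H c) : sw B (k *: u) = sw (fun s t => k *: B s t) u.
  have kl : linear (fun w : W => k *: w) by lin.
  by rewrite -[LHS]/(linear_of Bl _) linearZ /= (sw_comp _ _ kl).
under eq_sw => u v do rewrite Bs.
rewrite (sw_coassoc (bc := b)); try grp.
apply: eq_sw => s r; rewrite [RHS](sw_comp _ _ (Bb.1 s)).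
by apply: eq_sw => t v; rewrite -[RHS]/(linear_of (Bb.1 s) _) linearZ.
Qed.

Definition trace_form (p : H 1%g -> K) c (x : H c) : K^o :=
  trace (fun y : H c => contr_form p (x ∗ Q y)).

Lemma linear_trace_form p c : linear (@trace_form p c).
Proof. by apply: linear_trace => y; apply: linear_contr_form; lin. Qed.

(** The first leg is tested against a form [f] to keep the traces scalar-valued; coordinate forms
    later recover the integral equation. *)
Lemma trace_form_integral p a b c (f : H a -> K^o) (x : H c) :
  linear f -> c = (a * b)%g ->
  sw (fun x1 (x2 : H b) => (f x1 : K) *: trace_form p x2) x =
  (f aone : K) *: trace_form p x.
Proof.
move=> fl ec; rewrite /trace_form.
under eq_sw => x1 x2 do rewrite -trace_scale.
rewrite -[LHS]trace_tlift.
transitivity (trace (fun y : H b => sw (fun (y1 : H (a^-1)%g) (y2 : H c) =>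
    sw (fun s t => (f (s ∗ S a y1) : K) *: t) (contr_form p (x ∗ Q y2))) y)).
  apply: eq_trace => y.
  rewrite [LHS](sw_mul_antipode2 (a' := (a^-1)%g)
    (B := fun x1 (x2 : H b) => (f x1 : K) *: contr_form p x2)) //; last first.
    split=> [u|v]; last by lin.
    by apply: linear_scale; apply: linear_contr_form; lin.
  apply: eq_sw => y1 y2; rewrite sw_contr_form //.
  lin.
(* Cyclicity, with Delta on H_b and Delta_{a,b} as the two maps, turns the trace over H_b into one
   over H_c and places S(y_1) where coassociativity cancels it. *)
etransitivity.
  apply: (@trace_cyc K (H b) (H (a^-1)%g) (H a) (H c)
    (fun y => comult H _ _ (cast _ y)) (fun w => comult H a b (cast _ w))
    (fun w => contr_form p (x ∗ Q w)) (fun s y1 => f (s ∗ S a y1)));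
  by apply/linear_app/linear_cast; lin.
rewrite -[RHS]trace_scale; apply: eq_trace => w.
rewrite -[LHS]/(sw (fun s (t : H b) => sw _ t) w).
rewrite -(sw_coassoc (ab := 1%g)); try grp.
under eq_sw => u v.
  rewrite (sw_antipoder (F := fun z => (f z : K) *: contr_form p (x ∗ Q v))); [|lin|grp].
over.
rewrite (sw_counitl (B := fun v => (f aone : K) *: contr_form p (x ∗ Q v))) //.
apply: linear_scale; apply: linear_contr_form; lin.
Qed.

End LeftIntegral.

(** * A nonzero left integral, and its uniqueness up to scalars *)

Section Uniqueness.
Variables (K : fieldType) (G : groupType) (H : hopfPiCoalgebra K G).
Implicit Types (a b c : G) (W : lmodType K) (lam mu : form_family H).

Local Notation eps x := (counit H x : K).
Local Notation Q := antipode2.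

(** Summed over dual bases, the values give the trace of w |-> eps(w) 1, which is eps(1) = 1 in any
    characteristic; so some summand is nonzero. *)
Lemma trace_form_neq0 :
  exists p (x : H 1%g), linear (p : H 1%g -> K^o) /\ trace_form p x != 0.
Proof.
pose e j := (vbasis {:H 1%g})`_j; pose p j := coord (vbasis {:H 1%g}) j.
have tr1 : \sum_j trace_form (p j) (S 1%g (e j)) = 1.
  rewrite (@trace_comult K (H 1%g) (fun x => comult H 1%g 1%g (cast _ x))
    (fun w1 w2 => S 1%g w2 ∗ Q w1)); last by apply/linear_app/linear_cast; lin.
  transitivity (trace (fun w : H 1%g => eps w *: (aone : H 1%g))).
    apply: eq_trace => w.
    exact: (sw_antipode_antipode2 w (@linear_id _ _) (esym (invg1 _))).
  by rewrite (trace_rank1 (f := counit H)); [case: (counit_morph H)|lin].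
apply: contrapT => no; have /eqP := oner_neq0 K; apply; rewrite -[LHS]tr1.
rewrite big1 // => j _; apply/eqP/negPn/negP => nz; apply: no.
by exists (p j), (S 1%g (e j)); split => //; apply: linearP.
Qed.

Lemma left_integralP lam : is_left_integral lam <->
  forall a b c (x : H c), c = (a * b)%g ->
    sw (fun (u : H a) (v : H b) => (lam b v : K) *: u) x = (lam c x : K) *: aone.
Proof.
split=> [il a b c x e|il a b x]; last by rewrite -(il a b) // /sw cast_id.
by subst c; rewrite -il /sw cast_id.
Qed.

Lemma right_integralP lam : is_right_integral lam <->
  forall a b c (x : H c), c = (a * b)%g ->
    sw (fun (u : H a) (v : H b) => (lam a u : K) *: v) x = (lam c x : K) *: aone.
Proof.
split=> [il a b c x e|il a b x]; last by rewrite -(il a b) // /sw cast_id.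
by subst c; rewrite -il /sw cast_id.
Qed.

Lemma exists_left_integral :
  exists lam (x : H 1%g), is_left_integral lam /\ lam 1%g x != 0.
Proof.
have [p [x [pl px]]] := trace_form_neq0.
exists (fun a => linfun (linear_of (@linear_trace_form K G H p a))), x.
rewrite lfunE; split=> //; apply/left_integralP => a b c y e.
rewrite lfunE; apply: vect_ext => i.
under eq_sw => u v do rewrite lfunE.
have cl : linear (fun u : H a => coord (vbasis {:H a}) i u : K^o) by apply: linearP.
rewrite (sw_comp _ _ cl).
under eq_sw => u v do rewrite linearZ /= mulrC.
rewrite [LHS](trace_form_integral (b := b) p y cl e).
by rewrite linearZ /= mulrC.
Qed.

(* [H] acts on forms by [lam . h = lam (_ S(h))]: this is the compatibility of *)
(* that action with the coaction whose coinvariants are the integrals.        *)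
Lemma left_integral_antipode lam a a' (u : H 1%g) (h : H a) :
  is_left_integral lam -> a' = (a^-1)%g ->
  sw (fun (h1 : H 1%g) (h2 : H a) => (lam 1%g (u ∗ S 1%g h1) : K) *: h2) h =
  sw (fun (u1 : H a) (u2 : H a') => (lam a' (u2 ∗ S a' h) : K) *: u1) u.
Proof.
move=> /left_integralP il ea'.
have ll b : linear (fun x : H b => lam b x) by apply: linearP.
have aa' : 1%g = (a * a')%g by grp.
(* The integral equation for w = u S(h_1) replaces lam_1(w) 1 by w_1 lam(w_2). Then w_1 contains S
   of the second leg of h_1, which cancels against h_2. *)
transitivity (sw (fun (h1 : H 1%g) (h2 : H a) =>
  sw (fun (w1 : H a) (w2 : H a') => (lam a' w2 : K) *: (w1 ∗ h2)) (u ∗ S 1%g h1)) h).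
  apply: eq_sw => h1 h2.
  have ml : linear (fun z : H a => z ∗ h2) by lin.
  have mZ k (z : H a) : (k *: z) ∗ h2 = k *: (z ∗ h2).
    exact: (linear_scalable _ _ ml).
  rewrite -{1}[h2]amul1l -mZ -(il a a') // (sw_comp _ _ ml).
  by apply: eq_sw => s t; rewrite mZ.
have Bb (h2 : H a) : bilin (fun (w1 : H a) (w2 : H a') => (lam a' w2 : K) *: (w1 ∗ h2)).
  by split=> ?; [apply: linear_scalel; exact: ll|lin].
under eq_sw => h1 h2 do rewrite (sw_mul _ _ (Bb h2) aa').
under eq_sw => h1 h2.
  under eq_sw => u1 u2.
    rewrite (sw_antipode (a := a) (b := a')); try grp; last first.
      split=> ?; last by lin.
      by apply: linear_scalel; apply: (linear_comp (ll a')); lin.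
  over.
over.
rewrite exchange_sw; apply: eq_sw => u1 u2.
rewrite (sw_coassoc (bc := 1%g)); try grp.
under eq_sw => x1 r.
  under eq_sw => x2 h2 do rewrite -amulA.
  rewrite (sw_antipodel (F := fun z : H a => (lam a' (u2 ∗ S a' x1) : K) *: (u1 ∗ z)));
    [|lin|grp].
over.
rewrite (sw_counitr (B := fun x1 : H a => (lam a' (u2 ∗ S a' x1) : K) *: (u1 ∗ aone))).
  by rewrite amul1r.
by apply: linear_scalel; apply: (linear_comp (ll a')); lin.
Qed.

(** Left legs of Delta_{1,a}(h): claims about this tensor become claims about elements of H_1. *)
Let leg a (p : H a -> K) (h : H a) : H 1%g := sw (fun u v => p v *: u) h.

Let sw_leg a W (f : H 1%g -> H a -> W) (h : H a) : bilin f ->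
  sw f h = \sum_j f (leg (coord (vbasis {:H a}) j) h) (vbasis {:H a})`_j.
Proof. exact: tlift_coord. Qed.

Let leg_counit a (h : H a) :
  h = \sum_j eps (leg (coord (vbasis {:H a}) j) h) *: (vbasis {:H a})`_j.
Proof.
rewrite -[LHS](sw_counitl (B := id) h); last by lin.
by rewrite sw_leg //; lin.
Qed.

Let form_leg lam a p (u : H 1%g) (h : H a) : linear (p : H a -> K^o) ->
  lam 1%g (u ∗ S 1%g (leg p h)) =
  p (sw (fun (h1 : H 1%g) (h2 : H a) => (lam 1%g (u ∗ S 1%g h1) : K) *: h2) h).
Proof.
move=> pl; rewrite -[RHS]/((p : H a -> K^o) _) [RHS](sw_comp _ _ pl).
have ml : linear (fun z : H 1%g => lam 1%g (u ∗ S 1%g z)) by lin.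
etransitivity; first exact: (sw_comp _ _ ml).
apply: (@eq_sw K G H _ _ _ K^o) => h1 h2.
rewrite (linear_scalable _ _ pl) (linear_scalable _ _ ml).
exact: mulrC.
Qed.

Section Nondegenerate.
Variables (lam : form_family H) (x0 : H 1%g).
Hypotheses (il : is_left_integral lam) (lx0 : lam 1%g x0 != 0).

(** The kernel of k |-> lam_1(_ S(k)) is stable under taking legs, since lam_1(u S(k_1)) k_2 = u_1
    lam_1(u_2 S(k)) = 0. *)
Let antipode_form_leg (k : H 1%g) :
  (forall u, lam 1%g (u ∗ S 1%g k) = 0) ->
  forall j u, lam 1%g (u ∗ S 1%g (leg (coord (vbasis {:H 1%g}) j) k)) = 0.
Proof.
move=> k0 j u.
rewrite form_leg ?(left_integral_antipode (a' := 1%g)) ?invg1 //; last exact: linearP.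
under eq_sw => u1 u2 do rewrite k0 scale0r.
by rewrite /sw tlift0 linear0.
Qed.

(** The value lam_1(x0 Q(k_2) S(k_1)) equals eps(k) lam_1(x0), but vanishes because every leg k_1
    lies in the kernel. *)
Let antipode_form_counit (k : H 1%g) :
  (forall u, lam 1%g (u ∗ S 1%g k) = 0) -> eps k = 0.
Proof.
move=> k0; have Fl : linear (fun z => lam 1%g (x0 ∗ z)) by lin.
have := sw_antipode2_antipode k Fl (esym (invg1 G)).
rewrite sw_leg; last by lin.
rewrite big1 => [|j _]; last by rewrite amulA antipode_form_leg.
rewrite amul1r => /esym /eqP; rewrite scaler_eq0 (negPf lx0) orbF.
by move/eqP.
Qed.

Let antipode_form_inj1 (k : H 1%g) :
  (forall u, lam 1%g (u ∗ S 1%g k) = 0) -> k = 0.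
Proof.
move=> k0; rewrite [k]leg_counit big1 // => j _.
by rewrite antipode_form_counit ?scale0r //; apply: antipode_form_leg.
Qed.

(** If S(h) = 0, then lam_1(u S(h_1)) h_2 = 0 for all u, so all legs of h in H_1 vanish, and h with
    them. *)
Lemma antipode_inj a c (h : H a) : c = (a^-1)%g -> S c h = 0 -> h = 0.
Proof.
move=> e h0; rewrite [h]leg_counit big1 // => j _.
suff -> : leg (coord (vbasis {:H a}) j) h = 0 by rewrite linear0 scale0r.
apply: antipode_form_inj1 => u.
rewrite form_leg ?(left_integral_antipode (a' := c)) //; last exact: linearP.
under eq_sw => u1 u2.
  rewrite h0 -[_ ∗ _]/(linear_of (@amul_linr K (H c) u2) 0) !linear0 scale0r.
over.
by rewrite /sw tlift0 linear0.
Qed.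

(** Injectivity of S in both directions makes the dimensions of inverse degrees equal. *)
Lemma antipode_surj a c (v : H c) : c = (a^-1)%g -> exists u : H a, S c u = v.
Proof.
move=> e; apply: linear_inj_surj; first by lin.
  by move=> u; apply: antipode_inj.
apply: (@linear_inj_dim _ _ _ (S a)); first by lin.
by move=> u; apply: antipode_inj; grp.
Qed.

(** The map h |-> lam_1(_ S(h)) from H_1 to its dual is injective between spaces of equal
    dimension. *)
Let form_antipodeE mu : exists h : H 1%g, forall u, mu 1%g u = lam 1%g (u ∗ S 1%g h).
Proof.
have hl (h : H 1%g) : linear (fun u : H 1%g => lam 1%g (u ∗ S 1%g h)) by lin.
pose f (h : H 1%g) : 'Hom(H 1%g, K^o) := linfun (linear_of (hl h)).
have fE h u : f h u = lam 1%g (u ∗ S 1%g h) by rewrite lfunE.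
have fl : linear f.
  move=> k x y; apply/lfunP => u; rewrite add_lfunE scale_lfunE !fE.
  have gl : linear (fun h : H 1%g => lam 1%g (u ∗ S 1%g h)) by lin.
  exact: gl.
have [h fh] : exists h, f h = mu 1%g.
  apply: linear_inj_surj => // [h h0|]; last by rewrite !dimvf /dim /= muln1.
  by apply: antipode_form_inj1 => u; rewrite -fE h0 zero_lfunE.
by exists h => u; rewrite -fE fh.
Qed.

Lemma left_integral_unique mu : is_left_integral mu -> exists k : K, mu = k *: lam.
Proof.
move=> im; have [h hE] := form_antipodeE mu.
exists (eps h).
(* This is h_1 ⊗ h_2 = h ⊗ 1: as mu is an integral, lam_1(u S(h_1)) h_2 = u_1 mu_1(u_2) = mu_1(u)
   1. *)
have legE j : leg (coord (vbasis {:H 1%g}) j) h = coord (vbasis {:H 1%g}) j aone *: h.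
  apply/eqP; rewrite -subr_eq0; apply/eqP/antipode_form_inj1 => u.
  have gl : linear (fun h : H 1%g => lam 1%g (u ∗ S 1%g h)) by lin.
  rewrite -[LHS]/(linear_of gl _) linearB linearZ /=.
  rewrite form_leg ?(left_integral_antipode (a' := 1%g)) ?invg1 //; last exact: linearP.
  under eq_sw => u1 u2 do rewrite -hE.
  have /left_integralP imE := im.
  rewrite imE ?mulg1 // linearZ /= hE -[_ *: _]/(_ * _) mulrC subrr //.
have hS : h = eps h *: aone.
  rewrite [LHS]leg_counit [in RHS](coord_vbasis (memvf aone)) scaler_sumr.
  by apply: eq_bigr => j _; rewrite legE linearZ /= scalerA mulrC.
have muE (u : H 1%g) : mu 1%g u = eps h * lam 1%g u.
  rewrite hE {1}hS; have gl : linear (fun h : H 1%g => lam 1%g (u ∗ S 1%g h)) by lin.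
  by rewrite [LHS](linear_scalable _ _ gl) /= antipode_one ?invg1 // amul1r.
apply: functional_extensionality_dep => a; apply/lfunP => x.
rewrite scale_lfunE -[RHS]/(eps h * lam a x).
(* The integral equations only compare multiples of the unit of H_a; if that unit is 0, then H_a = 0
   and all forms on it agree. *)
have [one0|/eqP one0] := eqVneq (aone : H a) 0.
  have x0' : x = 0.
    rewrite -[LHS]amul1l one0.
    exact: (linear0 (linear_of (@amul_linl K (H a) x))).
  by rewrite x0' !linear0 mulr0.
have /left_integralP imE := im; have /left_integralP ilE := il.
have := imE a 1%g a x (esym (mulg1 a)).
under eq_sw => u v do rewrite muE -scalerA.
have sl : linear (fun z : H a => eps h *: z) by lin.
rewrite -(sw_comp _ _ sl) ilE ?mulg1 // scalerA => /eqP.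
rewrite -subr_eq0 -scalerBl scaler_eq0 => /orP[|/eqP //].
by rewrite subr_eq0 => /eqP <-.
Qed.

End Nondegenerate.

End Uniqueness.

(** * Transfer to right integrals through the antipode *)

Section RightIntegral.
Variables (K : fieldType) (G : groupType) (H : hopfPiCoalgebra K G).
Variables (lam : form_family H) (x0 : H 1%g).
Hypotheses (il : is_left_integral lam) (lx0 : lam 1%g x0 != 0).

Fact form_antipode_linear (rho : form_family H) a :
  linear (fun x : H a => rho (a^-1)%g (S (a^-1)%g x)).
Proof. lin. Qed.

Definition form_antipode (rho : form_family H) : form_family H :=
  fun a => linfun (linear_of (@form_antipode_linear rho a)).

Lemma form_antipodeE rho a c (x : H a) :
  c = (a^-1)%g -> form_antipode rho a x = rho c (S c x).
Proof. by move=> ->; rewrite lfunE. Qed.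

(** S exchanges the legs of Delta; the two sides are compared after applying the injective S_b. *)
Lemma right_integral_form_antipode rho :
  is_left_integral rho -> is_right_integral (form_antipode rho).
Proof.
move=> /left_integralP ir; apply/right_integralP => a b c x e.
have eV : (c^-1 = b^-1 * a^-1)%g by grp.
apply/eqP; rewrite -subr_eq0; apply/eqP/(antipode_inj il lx0 (erefl (b^-1)%g)).
have Sl : linear (fun z : H b => S (b^-1)%g z) by lin.
rewrite -[LHS]/(linear_of Sl _) linearB linearZ /= antipode_one // (sw_comp _ _ Sl).
rewrite (form_antipodeE _ _ erefl) -(ir _ _ _ _ eV) (sw_antipode (a := a) (b := b)) //; last first.
  by split=> ?; [apply/linear_scalel/linearP|lin].
apply/eqP; rewrite subr_eq0; apply/eqP/eq_sw => u v.
by rewrite (form_antipodeE _ _ erefl) (linear_scalable _ _ Sl).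
Qed.

Lemma left_integral_form_antipode rho :
  is_right_integral rho -> is_left_integral (form_antipode rho).
Proof.
move=> /right_integralP ir; apply/left_integralP => a b c x e.
have eV : (c^-1 = b^-1 * a^-1)%g by grp.
apply/eqP; rewrite -subr_eq0; apply/eqP/(antipode_inj il lx0 (erefl (a^-1)%g)).
have Sl : linear (fun z : H a => S (a^-1)%g z) by lin.
rewrite -[LHS]/(linear_of Sl _) linearB linearZ /= antipode_one // (sw_comp _ _ Sl).
rewrite (form_antipodeE _ _ erefl) -(ir _ _ _ _ eV) (sw_antipode (a := a) (b := b)) //; last first.
  by split=> ?; [lin|apply/linear_scalel/linearP].
apply/eqP; rewrite subr_eq0; apply/eqP/eq_sw => u v.
by rewrite (form_antipodeE _ _ erefl) (linear_scalable _ _ Sl).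
Qed.

(** Each S_a is onto, so a form is determined by its composite with S. *)
Lemma form_antipode_inj rho rho' k :
  (forall a (x : H a), form_antipode rho a x = k * form_antipode rho' a x :> K) ->
  rho = k *: rho'.
Proof.
move=> E; apply: functional_extensionality_dep => a; apply/lfunP => y.
rewrite scale_lfunE -[RHS]/(k * rho' a y).
have [x <-] := antipode_surj il lx0 y (esym (invgK a)).
by have := E _ x; rewrite !(form_antipodeE _ _ (esym (invgK a))).
Qed.

Lemma exists_right_integral :
  exists rho (x : H 1%g), is_right_integral rho /\ rho 1%g x != 0.
Proof.
have [x Sx] := antipode_surj il lx0 x0 (esym (invg1 G)).
exists (form_antipode lam), x; split; first exact: right_integral_form_antipode.
by rewrite (form_antipodeE _ _ (esym (invg1 G))) Sx.
Qed.

Lemma right_integral_unique rho mu (x : H 1%g) :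
  is_right_integral rho -> rho 1%g x != 0 -> is_right_integral mu ->
  exists k : K, mu = k *: rho.
Proof.
move=> ir rx im.
have [k Ek] := left_integral_unique il lx0 (left_integral_form_antipode ir).
have [l El] := left_integral_unique il lx0 (left_integral_form_antipode im).
(* If k were 0, then rho composed with S would vanish, hence also rho. *)
have k0 : k != 0.
  apply: contraNneq rx => k0; have -> : rho = 0 *: rho; last by rewrite scale0r zero_lfunE.
  apply: form_antipode_inj => a y.
  by rewrite mul0r Ek k0 scale0r zero_lfunE.
exists (l / k); apply: form_antipode_inj => a y.
rewrite Ek El !scale_lfunE -!/(_ * _) mulrA divfK //.
Qed.

End RightIntegral.

(** The coordinate [k] is obtained by choice; v != 0 makes it unique, hence linear. *)
Lemma has_dimension1 (K : fieldType) (V : lmodType K) (v : V) :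
  v != 0 -> (forall w, exists k : K, w = k *: v) -> has_dimension V 1.
Proof.
move=> v0 vV; pose k w := sval (cid (vV w)).
have kE w : w = k w *: v by rewrite /k; case: cid.
have kP a w : w = a *: v -> k w = a.
  rewrite [w in LHS]kE => /eqP; rewrite -subr_eq0 -scalerBl scaler_eq0 (negPf v0) orbF.
  by rewrite subr_eq0 => /eqP.
constructor; exists (fun w => (k w)%:M : 'rV[K]_1).
  move=> a x y; rewrite (kP (a * k x + k y)).
    by rewrite raddfD /= -scale_scalar_mx.
  by rewrite scalerDl -scalerA -!kE.
exists (fun r : 'rV[K]_1 => r 0 0 *: v) => [w|r]; first by rewrite mxE mulr1n -kE.
by rewrite (kP (r 0 0)) // -mx11_scalar.
Qed.

Theorem theorem3 (K : fieldType) (G : groupType) (H : hopfPiCoalgebra K G) :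
  has_dimension (left_integrals H) 1 /\ has_dimension (right_integrals H) 1.
Proof.
have [lam [x [il lx]]] := exists_left_integral H.
split.
  have pl : lam \in left_integral (H := H) by apply/asboolP.
  apply: (@has_dimension1 K (left_integrals H) (LeftIntegral pl)).
    apply: contraNneq lx => /(congr1 (@left_form _ _ _)) /= ->.
    by rewrite zero_lfunE.
  move=> [mu pm]; have [k Ek] := left_integral_unique il lx (asboolW pm).
  by exists k; apply: val_inj.
have [rho [y [ir ry]]] := exists_right_integral il lx.
have pr : rho \in right_integral (H := H) by apply/asboolP.
apply: (@has_dimension1 K (right_integrals H) (RightIntegral pr)).
  apply: contraNneq ry => /(congr1 (@right_form _ _ _)) /= ->.
  by rewrite zero_lfunE.
move=> [mu pm]; have [k Ek] := right_integral_unique il lx ir ry (asboolW pm).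
by exists k; apply: val_inj.
Qed.
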